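(* The set $\ell^{\infty\infty}(\mathbb{Z})$ of smooth functions on $\beta(\mathbb{Z})$ is a $\star$-subalgebra of $\ell^\infty(\mathbb{Z})$ (under pointwise operations, with pointwise complex conjugation as involution), it is dense in $\ell^\infty(\mathbb{Z})$ for the sup-norm $\|\cdot\|_\infty$, and it contains $\ell^\infty_c(\mathbb{Z})$.
   Context: $\ell^\infty(\mathbb{Z})$ is the $C^\star$-algebra of all bounded functions $\varphi:\mathbb{Z}\to\mathbb{C}$ with pointwise multiplication, involution given by pointwise complex conjugation, and norm $\|\varphi\|_\infty=\sup_{n\in\mathbb{Z}}|\varphi(n)|$. $\beta(\mathbb{Z})$ is the Stone-Čech compactification of the discrete set $\mathbb{Z}$, with $\mathbb{Z}\subseteq\beta(\mathbb{Z})$. Each $\varphi\in\ell^\infty(\mathbb{Z})$ extends to a continuous function on $\beta(\mathbb{Z})$, again denoted $\varphi$: for $n_0\in\beta(\mathbb{Z})$, $\varphi(n_0)=\lim_\alpha \varphi(n_\alpha)$ for any net $\{n_\alpha\}$ of integers converging to $n_0$. A projection in $\ell^\infty(\mathbb{Z})$ is a function $p$ with $p(n)\in\{0,1\}$ for every $n\in\mathbb{Z}$. $\ell^\infty_c(\mathbb{Z})$ is the set of finite complex linear combinations of projections in $\ell^\infty(\mathbb{Z})$. For each $n_0\in\beta(\mathbb{Z})$ choose a net $\{n_\alpha\}_{\alpha\in\Lambda}$ of integers converging to $n_0$. The set of smooth functions on $\beta(\mathbb{Z})$, denoted $\ell^{\infty\infty}(\mathbb{Z})$ (or $C^\infty(\beta(\mathbb{Z}))$),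 consists of those $\varphi\in\ell^\infty(\mathbb{Z})$ such that $$\lim_{\alpha\in\Lambda} n_\alpha^d\bigl(\varphi(n_\alpha)-\varphi(n_0)\bigr)=0$$ for each $d=0,1,2,\dots$ and each $n_0\in\beta(\mathbb{Z})$; this condition does not depend on the choice of the nets. *)

(* Defs.v *)
From HB Require Import structures.
From mathcomp Require Import all_boot all_order all_algebra.
From mathcomp Require Import all_classical all_reals all_analysis.
From mathcomp Require Import complex.

Set Implicit Arguments.
Unset Strict Implicit.
Unset Printing Implicit Defensive.

Import Order.TTheory GRing.Theory Num.Theory.
Import numFieldNormedType.Exports.

Local Open Scope classical_set_scope.
Local Open Scope ring_scope.

(* The Stone-Cech compactification of a discrete space T, realised as the
   space of ultrafilters on T with the topology whose basic open sets are the
   [set x | A \in x] for A a subset of T. The facts beta_compact,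
   beta_hausdorff, beta_pt_inj, beta_pt_open, beta_pt_dense and beta_universal
   below show that it has the defining properties. *)
Record beta (T : Type) := Beta {
  beta_filter : set_system T;
  beta_ultra : UltraFilter beta_filter }.

Arguments beta_ultra {T} _.

#[global] Existing Instance beta_ultra.

Lemma beta_filter_inj (T : Type) : injective (@beta_filter T).
Proof.
by move=> [F UF] [G UG] /= FG; subst G; congr Beta; exact: Prop_irrelevance.
Qed.

HB.instance Definition _ (T : Type) := gen_eqMixin (beta T).
HB.instance Definition _ (T : Type) := gen_choiceMixin (beta T).

Section beta_topology.
Variable T : Type.

Definition beta_nbhs (x : beta T) : set_system (beta T) :=
  filter_from (beta_filter x) (fun A => [set y | beta_filter y A]).

Let beta_nbhs_filter (x : beta T) : ProperFilter (beta_nbhs x).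
Proof.
apply: filter_from_proper; last by move=> A xA; exists x.
apply: filter_from_filter; first by exists setT; exact: filterT.
move=> A B xA xB; exists (A `&` B); first exact: filterI.
by move=> y yAB; split; apply: filterS yAB => t [].
Qed.

Let beta_nbhs_singleton (x : beta T) U : beta_nbhs x U -> U x.
Proof. by move=> [A xA]; apply. Qed.

Let beta_nbhs_nbhs (x : beta T) (U : set (beta T)) :
  beta_nbhs x U -> beta_nbhs x (beta_nbhs^~ U).
Proof. by move=> [A xA AU]; exists A => // y yA; exists A. Qed.

HB.instance Definition _ := hasNbhs.Build (beta T) beta_nbhs.
HB.instance Definition _ := @Nbhs_isNbhsTopological.Build (beta T)
  beta_nbhs_filter beta_nbhs_singleton beta_nbhs_nbhs.

Lemma ultra_of_setVsetC (I : Type) (F : set_system I) : ProperFilter F ->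
  (forall A, F A \/ F (~` A)) -> UltraFilter F.
Proof.
move=> PF FC; split=> // G PG FG; apply/seteqP; split=> // A GA.
case: (FC A) => // /FG GCA.
by have /filter_ex[i []] : G (A `&` ~` A) by exact: filterI.
Qed.

Lemma ultra_fmap (I J : Type) (f : I -> J) (F : set_system I) :
  UltraFilter F -> UltraFilter (f @ F).
Proof.
move=> UF; apply: ultra_of_setVsetC => A.
exact: (in_ultra_setVsetC (f @^-1` A) UF).
Qed.

Definition beta_pt (t : T) : beta T := Beta (principal_filter_ultra t).

Lemma beta_pt_inj : injective beta_pt.
Proof.
move=> s t /(congr1 (@beta_filter T)) /= st.
have : principal_filter s [set t] by rewrite st; exact/principal_filterP.
by move/principal_filterP.
Qed.

Lemma beta_pt_open (t : T) : open [set beta_pt t].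
Proof.
rewrite openE => _ ->; exists [set t]; first exact/principal_filterP.
move=> y yt; apply: beta_filter_inj => /=.
apply/seteqP; split=> A.
  move=> yA; have /filter_ex[s [-> ?]] : beta_filter y ([set t] `&` A).
    exact: filterI.
  exact/principal_filterP.
by move/principal_filterP => At; apply: filterS yt => _ ->.
Qed.

Lemma beta_pt_dense : dense (range beta_pt).
Proof.
move=> O [x Ox] oO; have [A xA AO] : nbhs x O by exact: open_nbhs_nbhs.
have [t At] := filter_ex xA; exists (beta_pt t); split; last by exists t.
exact/AO/principal_filterP.
Qed.

Lemma beta_compact : compact [set: beta T].
Proof.
rewrite compact_ultra => F UF _.
pose G : set_system T := [set A | F [set x | beta_filter x A]].
have PG : ProperFilter G.
  apply: Build_ProperFilter_ex.
    move=> A GA; have [x xA] := filter_ex (GA : F _).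
    exact: filter_ex xA.
  split; rewrite /G /=.
  - by apply: (@filterS _ F _ setT) filterT => x _; exact: filterT.
  - move=> A B GA GB; apply: (@filterS _ F) (@filterI _ F _ _ _ GA GB) => x [? ?].
    exact: filterI.
  - by move=> A B AB; apply: (@filterS _ F) => x; exact: filterS.
have UG : UltraFilter G.
  apply: ultra_of_setVsetC => A.
  have [?|H] := in_ultra_setVsetC [set x | beta_filter x A] UF; first by left.
  right; apply: filterS H => x nxA.
  by have [] := in_ultra_setVsetC A (beta_ultra x).
exists (Beta UG); split=> // U [A GA AU].
exact: (@filterS _ F _ _ _ AU GA).
Qed.

Lemma beta_hausdorff : hausdorff_space (beta T).
Proof.
move=> x y xy; apply: beta_filter_inj.
suff: beta_filter x `<=` beta_filter y.
  by move=> /max_filter ->.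
move=> A xA; have [//|yA] := in_ultra_setVsetC A (beta_ultra y).
have nx : nbhs x [set z | beta_filter z A] by exists A.
have ny : nbhs y [set z | beta_filter z (~` A)] by exists (~` A).
have [z [zA zCA]] := xy _ _ nx ny.
by have /filter_ex[i []] : beta_filter z (A `&` ~` A) by exact: filterI.
Qed.

(* The extension of f to beta T. A point of beta T is the ultrafilter which its
   neighbourhoods trace on T, so this is the limit of f t as t in T tends to
   x; see beta_ext_continuous, beta_ext_pt and beta_ext_net, and linfty_cvg for
   the existence of the limit for bounded complex functions. *)
Definition beta_ext (K : ptopologicalType) (f : T -> K) (x : beta T) : K :=
  lim (f @ beta_filter x).

Lemma beta_ext_continuous (K : ptopologicalType) (f : T -> K) :
  regular_space K -> (forall x : beta T, cvg (f @ beta_filter x)) ->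
  continuous (beta_ext f).
Proof.
move=> rK cf x U /rK [V nV VU].
have xV : beta_filter x (f @^-1` V) by exact: (cf x).
exists (f @^-1` V) => // y yV; apply: VU => W nW.
have : beta_filter y (f @^-1` W) by exact: (cf y).
by move=> /(filterI yV) /filter_ex[t [? ?]]; exists (f t).
Qed.

Lemma beta_ext_pt (K : ptopologicalType) (f : T -> K) (t : T) :
  hausdorff_space K -> beta_ext f (beta_pt t) = f t.
Proof.
move=> hK; apply: (@cvg_lim _ hK).
by move=> U /nbhs_singleton Ut; exact/principal_filterP.
Qed.

Lemma beta_universal (K : ptopologicalType) (f : T -> K) :
  compact [set: K] -> hausdorff_space K ->
  exists! g : beta T -> K, continuous g /\ (forall t, g (beta_pt t) = f t).
Proof.
move=> cK hK; have rK : regular_space K.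
  by move=> k; exact: (compact_regular hK cK filterT).
exists (beta_ext f); split.
  split; last by move=> t; exact: beta_ext_pt.
  apply: beta_ext_continuous => // x.
  move: cK; rewrite compact_ultra.
  move=> /(_ (f @ beta_filter x) (ultra_fmap _ _) filterT)[p [_ xp]].
  by apply: (cvgP p).
move=> g [cg gf]; apply/funext => x.
apply: (@cvg_lim _ hK).
move=> U /cg [A xA AU]; apply: filterS xA => t At.
by rewrite /= -gf; apply: AU; exact/principal_filterP.
Qed.

End beta_topology.

Record net (T : Type) := Net {
  net_idx : Type;
  net_le : net_idx -> net_idx -> Prop;
  net_inhabited : inhabited net_idx;
  net_refl : forall a, net_le a a;
  net_trans : forall a b c, net_le a b -> net_le b c -> net_le a c;
  net_directed : forall a b, exists c, net_le a c /\ net_le b c;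
  net_val :> net_idx -> T }.

Arguments net_le {T} n _ _.

Definition net_tails (T : Type) (N : net T) : set_system (net_idx N) :=
  filter_from [set: net_idx N] (fun a => [set b | net_le N a b]).

Arguments net_tails {T} N _.

#[global] Instance net_tails_filter (T : Type) (N : net T) :
  ProperFilter (net_tails N).
Proof.
apply: filter_from_proper; last by move=> a _; exists a; exact: net_refl.
apply: filter_from_filter; first by have [a] := net_inhabited N; exists a.
move=> a b _ _; have [c [ac bc]] := net_directed a b.
by exists c => // d cd; split; apply: net_trans cd.
Qed.

Definition net_cvg (T : Type) (N : net T) (x : beta T) : Prop :=
  beta_pt (N a) @[a --> net_tails N] --> x.

Lemma net_cvgP (T : Type) (N : net T) (x : beta T) :
  net_cvg N x <-> N @ net_tails N `=>` beta_filter x.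
Proof.
split=> [Nx A xA|Nx U [A xA AU]].
  have : nbhs x [set y | beta_filter y A] by exists A.
  by move=> /Nx [a _ aA]; exists a => // b /aA/principal_filterP.
have [a _ aA] := Nx _ xA; exists a => // b /aA bA.
exact/AU/principal_filterP.
Qed.

Lemma net_exists (T : Type) (x : beta T) : exists N : net T, net_cvg N x.
Proof.
pose I := {p : set T * T | beta_filter x p.1 /\ p.1 p.2}.
have mkI A : beta_filter x A -> exists i : I, (sval i).1 = A.
  by move=> xA; have [t At] := filter_ex xA; exists (exist _ (A, t) (conj xA At)).
pose le (i j : I) := (sval j).1 `<=` (sval i).1.
have inh : inhabited I by have [i _] := mkI _ filterT.
have dir (i j : I) : exists k, le i k /\ le j k.
  have [k kE] := mkI _ (filterI (proj1 (svalP i)) (proj1 (svalP j))).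
  by exists k; rewrite /le kE; split=> t [].
exists (@Net T I le inh (fun=> @subset_refl _ _)
  (fun i j k ij jk => subset_trans jk ij) dir (fun i => (sval i).2)).
apply/net_cvgP => A /mkI[i iA]; exists i => // j ij.
by rewrite -iA; apply: ij; exact: (proj2 (svalP j)).
Qed.

Lemma beta_ext_net (T : Type) (K : ptopologicalType) (f : T -> K)
    (x : beta T) (N : net T) : cvg (f @ beta_filter x) -> net_cvg N x ->
  f (N a) @[a --> net_tails N] --> beta_ext f x.
Proof. by move=> cf /net_cvgP Nx U /cf; exact: Nx. Qed.

Section linfty.
Variable R : realType.

(* R[i] is presented through its numClosedFieldType structure because this is
   what carries its topology. *)
Definition Cplx : numClosedFieldType := R[i].

Definition linfty : set (int -> Cplx) := [set phi | bounded_fun phi].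

(* Meaningful on linfty only: sup is 0 on unbounded sets. *)
Definition sup_norm (phi : int -> Cplx) : R :=
  sup (range (fun n => Normc.normc (phi n))).

Definition conj_fun (phi : int -> Cplx) : int -> Cplx := fun n => (phi n)^*.

Definition star_subalgebra (A S : set (int -> Cplx)) : Prop :=
  [/\ S `<=` A,
      S 0 /\ (forall phi psi, S phi -> S psi -> S (phi + psi)),
      forall (c : Cplx) phi, S phi -> S (c *: phi),
      forall phi psi, S phi -> S psi -> S (phi * psi)
    & forall phi, S phi -> S (conj_fun phi)].

Definition sup_norm_dense (A S : set (int -> Cplx)) : Prop :=
  forall phi, A phi -> forall e : R, 0 < e ->
  exists2 psi, S psi & sup_norm (phi - psi) < e.

Definition projection (p : int -> Cplx) : Prop :=
  forall n, p n = 0 \/ p n = 1.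

Definition linfty_c : set (int -> Cplx) := [set phi |
  exists (k : nat) (c : 'I_k -> Cplx) (p : 'I_k -> int -> Cplx),
    (forall i, projection (p i)) /\ phi = \sum_(i < k) c i *: p i].

(* N is the choice of a net of integers converging to each point of beta int. *)
Definition smooth (N : beta int -> net int) : set (int -> Cplx) := [set phi |
  linfty phi /\ forall (d : nat) (x : beta int),
    (N x a)%:~R ^+ d * (phi (N x a) - beta_ext phi x)
      @[a --> net_tails (N x)] --> (0 : Cplx)].

End linfty.

Arguments linfty R _ : clear implicits.
Arguments linfty_c R _ : clear implicits.
Arguments smooth R N _ : clear implicits.

Lemma linfty_cvg (R : realType) (phi : int -> Cplx R) (x : beta int) :
  linfty R phi -> cvg (phi @ beta_filter x).
Proof.
move=> [M0 [_ /(_ (M0 + 1)) M0phi]]; pose M := M0 + 1.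
have Mle n : Normc.normc (phi n) <= complex.Re M.
  have lt1 : M0 < M0 + 1 by rewrite ltrDl ltr01.
  have : `|phi n| <= M by exact: (M0phi lt1).
  by rewrite lecE => /andP[_].
have cvgR (f : int -> R) : (forall n, `|f n| <= complex.Re M) ->
    exists l : R, f @ beta_filter x --> l.
  move=> fM; have := @segment_compact R (- complex.Re M) (complex.Re M).
  rewrite compact_ultra => /(_ _ (ultra_fmap f (beta_ultra x)))[|l [_ fl]].
    apply: (@filterE _ (beta_filter x)) => n; rewrite /= in_itv /= -ler_norml.
    exact: fM.
  by exists l.
have [n|a fa] := cvgR (fun n => complex.Re (phi n)).
  apply: le_trans (Mle n).
  by have := normc_ge_Re (phi n); rewrite lecR.
have [n|b fb] := cvgR (fun n => complex.Im (phi n)).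
  apply: le_trans (Mle n); case: (phi n) => u v /=.
  by rewrite -sqrtr_sqr ler_wsqrtr // lerDr sqr_ge0.
apply: (cvgP (Complex a b : Cplx R)); apply/cvgrPdist_lt => e e0.
have eE : e = (complex.Re e)%:C%C.
  by case: (e) e0 => u v; rewrite ltcE /= => /andP[/eqP -> _].
have e2 : 0 < complex.Re e / 2.
  by move: e0; rewrite eE ltcR => ?; rewrite divr_gt0.
move/cvgrPdist_lt: fa => /(_ _ e2) fa.
move/cvgrPdist_lt: fb => /(_ _ e2) fb.
near=> n.
have na : `|a - complex.Re (phi n)| < complex.Re e / 2 by near: n.
have nb : `|b - complex.Im (phi n)| < complex.Re e / 2 by near: n.
rewrite eE normc_def ltcR /=.
case: (phi n) na nb => u v /= na nb.
rewrite [ltRHS]splitr; apply: le_lt_trans (ltrD na nb).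
rewrite -[leRHS]ger0_norm ?addr_ge0 // -sqrtr_sqr ler_wsqrtr //.
rewrite [leRHS]sqrrD !real_normK ?num_real // lerD2r lerDl.
by rewrite mulrn_wge0 // mulr_ge0.
Unshelve. all: by end_near. Qed.

Lemma linfty_ext_continuous (R : realType) (phi : int -> Cplx R) :
  linfty R phi -> continuous (beta_ext phi).
Proof.
by move=> bphi; apply: beta_ext_continuous => [|x];
  [exact: uniform_regular|exact: linfty_cvg].
Qed.

Lemma linfty_ext_pt (R : realType) (phi : int -> Cplx R) (n : int) :
  beta_ext phi (beta_pt n) = phi n.
Proof. exact/beta_ext_pt/norm_hausdorff. Qed.

Lemma linfty_ext_net (R : realType) (phi : int -> Cplx R) (x : beta int)
    (N : net int) : linfty R phi -> net_cvg N x ->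
  phi (N a) @[a --> net_tails N] --> beta_ext phi x.
Proof. by move=> bphi; apply: beta_ext_net; exact: linfty_cvg. Qed.

(* Main.v *)
Require Import Defs.
From mathcomp Require Import all_boot all_order all_algebra.
From mathcomp Require Import all_classical all_reals all_analysis.
From mathcomp Require Import finmap complex ring.

Import Order.TTheory GRing.Theory Num.Theory.
Import numFieldNormedType.Exports.

Local Open Scope classical_set_scope.
Local Open Scope ring_scope.

(** Smoothness at a point x of beta int says that phi - phi(x) decays faster
    than any power of n along a net tending to x. The limit phi(x) is additive,
    multiplicative and compatible with conjugation in phi, so the smooth
    functions form a star-subalgebra; for products one uses
      (phi psi)(n) - (phi psi)(x)
        = (phi(n) - phi(x)) psi(n) + phi(x) (psi(n) - psi(x)),
    where psi(n) stays convergent along the net.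

    A projection p is the indicator of a set of integers, and an ultrafilter
    contains that set or its complement; hence p is eventually equal to p(x)
    along every net tending to x, the quantity to be sent to 0 is eventually
    0, and p is smooth ([smooth_projection]). The subalgebra property then
    gives all of [linfty_c].

    Density already holds for [linfty_c] ([linfty_c_dense]). Given phi and e,
    the set of n with |phi(n) - phi(x)| < e belongs to the ultrafilter x, and
    the compactness of beta int ([ultrafilter_cover]) yields finitely many x
    whose sets cover the integers. Sending n to phi(x), for one of these x
    whose set contains n, gives a function with finitely many values, that is,
    a combination of projections, within e of phi. *)

(** * Bounded functions *)

Lemma linftyP {R : realType} {phi : int -> Cplx R} :
  linfty R phi <-> exists M : Cplx R, forall n, `|phi n| <= M.
Proof.
have PF : ProperFilter (globally [set: int]).
  exact: (globally_properfilter (a := 0)).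
rewrite /linfty /= ex_bound; split=> -[M phiM]; exists M => n.
  exact: phiM.
by move=> _; exact: phiM.
Qed.

Lemma linftyD {R : realType} (phi psi : int -> Cplx R) :
  linfty R phi -> linfty R psi -> linfty R (phi + psi).
Proof.
move=> /linftyP[M phiM] /linftyP[L psiL]; apply/linftyP; exists (M + L) => n.
exact: le_trans (ler_normD _ _) (lerD (phiM n) (psiL n)).
Qed.

Lemma linftyM {R : realType} (phi psi : int -> Cplx R) :
  linfty R phi -> linfty R psi -> linfty R (phi * psi).
Proof.
move=> /linftyP[M phiM] /linftyP[L psiL]; apply/linftyP; exists (M * L) => n.
by rewrite normrM ler_pM.
Qed.

Lemma linftyZ {R : realType} (c : Cplx R) (phi : int -> Cplx R) :
  linfty R phi -> linfty R (c *: phi).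
Proof.
move=> /linftyP[M phiM]; apply/linftyP; exists (`|c| * M) => n.
by rewrite normrM ler_wpM2l.
Qed.

Lemma linfty_conj {R : realType} (phi : int -> Cplx R) :
  linfty R phi -> linfty R (conj_fun phi).
Proof.
move=> /linftyP[M phiM]; apply/linftyP; exists M => n.
by rewrite norm_conjC.
Qed.

Lemma sup_norm_le {R : realType} (phi : int -> Cplx R) (e : R) :
  (forall n, `|phi n| <= e%:C%C) -> sup_norm phi <= e.
Proof.
move=> phie; apply: ge_sup; first by exists (Normc.normc (phi 0)); exists 0.
by move=> _ [n _ <-]; rewrite -lecR; exact: phie.
Qed.

(** * The extension to the Stone-Cech compactification *)

Lemma beta_ext_lim {R : realType} (phi : int -> Cplx R) (x : beta int) l :
  phi @ beta_filter x --> l -> beta_ext phi x = l.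
Proof. exact: (@cvg_lim _ (@norm_hausdorff _ _)). Qed.

Lemma cvg_beta_ext {R : realType} {phi : int -> Cplx R} (x : beta int) :
  linfty R phi -> phi @ beta_filter x --> beta_ext phi x.
Proof. exact: linfty_cvg. Qed.

Lemma beta_extD {R : realType} (phi psi : int -> Cplx R) (x : beta int) :
  linfty R phi -> linfty R psi ->
  beta_ext (phi + psi) x = beta_ext phi x + beta_ext psi x.
Proof. by move=> bphi bpsi; apply: beta_ext_lim; apply: cvgD; exact: cvg_beta_ext. Qed.

Lemma beta_extM {R : realType} (phi psi : int -> Cplx R) (x : beta int) :
  linfty R phi -> linfty R psi ->
  beta_ext (phi * psi) x = beta_ext phi x * beta_ext psi x.
Proof. by move=> bphi bpsi; apply: beta_ext_lim; apply: cvgM; exact: cvg_beta_ext. Qed.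

Lemma beta_extZ {R : realType} (c : Cplx R) (phi : int -> Cplx R) x :
  linfty R phi -> beta_ext (c *: phi) x = c * beta_ext phi x.
Proof. by move=> bphi; apply: beta_ext_lim; apply: cvgMr; exact: cvg_beta_ext. Qed.

Lemma beta_ext_conj {R : realType} (phi : int -> Cplx R) (x : beta int) :
  linfty R phi -> beta_ext (conj_fun phi) x = (beta_ext phi x)^*.
Proof.
move=> bphi; apply: beta_ext_lim; apply/cvgrPdist_lt => e e0.
have /cvgrPdist_lt/(_ e e0) := cvg_beta_ext x bphi.
by apply: filterS => n; rewrite /conj_fun -rmorphB norm_conjC.
Qed.

(** * The algebra of smooth functions *)

Lemma smoothD {R : realType} (N : beta int -> net int) (phi psi : int -> Cplx R) :
  smooth R N phi -> smooth R N psi -> smooth R N (phi + psi).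
Proof.
move=> [bphi sphi] [bpsi spsi]; split; first exact: linftyD.
move=> d x; rewrite beta_extD // -[0 in X in _ --> X]addr0.
under eq_fun do rewrite opprD addrACA mulrDr.
exact: cvgD (sphi d x) (spsi d x).
Qed.

Lemma smoothZ {R : realType} (N : beta int -> net int) (c : Cplx R)
    (phi : int -> Cplx R) :
  smooth R N phi -> smooth R N (c *: phi).
Proof.
move=> [bphi sphi]; split; first exact: linftyZ.
move=> d x; rewrite beta_extZ // -[0 in X in _ --> X](mulr0 c).
under eq_fun do rewrite -mulrBr mulrCA.
exact: cvgMr (sphi d x).
Qed.

Lemma smoothM {R : realType} (N : beta int -> net int)
    (hN : forall x, net_cvg (N x) x) (phi psi : int -> Cplx R) :
  smooth R N phi -> smooth R N psi -> smooth R N (phi * psi).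
Proof.
move=> [bphi sphi] [bpsi spsi]; split; first exact: linftyM.
move=> d x; rewrite beta_extM //.
have -> : 0 = 0 * beta_ext psi x + beta_ext phi x * 0 :> Cplx R.
  by rewrite mul0r mulr0 addr0.
have split_diff (m a b u v : Cplx R) :
    m * (a * b - u * v) = m * (a - u) * b + u * (m * (b - v)) by ring.
under eq_fun do rewrite split_diff.
apply: cvgD; last exact: cvgMr (spsi d x).
by apply: cvgM (sphi d x) _; exact: linfty_ext_net.
Qed.

Lemma smooth_conj {R : realType} (N : beta int -> net int)
    (phi : int -> Cplx R) :
  smooth R N phi -> smooth R N (conj_fun phi).
Proof.
move=> [bphi sphi]; split; first exact: linfty_conj.
move=> d x; apply/cvgr0Pnorm_lt => e e0.
have /cvgr0Pnorm_lt/(_ e e0) := sphi d x.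
apply: filterS => a.
by rewrite beta_ext_conj // /conj_fun -rmorphB !normrM norm_conjC.
Qed.

(** An ultrafilter decides whether p is 0 or 1, so p is eventually constant,
    and the power of n multiplies an exact 0. *)
Lemma smooth_projection {R : realType} (N : beta int -> net int)
    (hN : forall x, net_cvg (N x) x) (p : int -> Cplx R) :
  projection p -> smooth R N p.
Proof.
move=> proj_p; split.
  by apply/linftyP; exists 1 => n; case: (proj_p n) => ->; rewrite ?normr0 ?normr1.
move=> d x.
have [c xc] : exists c, beta_filter x [set n | p n = c].
  have [|xC] := in_ultra_setVsetC [set n | p n = 0] (beta_ultra x); first by exists 0.
  by exists 1; apply: filterS xC => n /= pn; case: (proj_p n).
have -> : beta_ext p x = c by apply: beta_ext_lim; apply: cvg_near_cst.
apply: cvg_near_cst.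
have Nc : \forall a \near net_tails (N x), p (N x a) = c.
  exact: (proj1 (net_cvgP _ _) (hN x) _ xc).
by apply: filterS Nc => a ->; rewrite subrr mulr0.
Qed.

Lemma smooth0 {R : realType} (N : beta int -> net int)
    (hN : forall x, net_cvg (N x) x) : smooth R N 0.
Proof. by apply: smooth_projection => // n; left. Qed.

Lemma linfty_c_smooth {R : realType} (N : beta int -> net int)
    (hN : forall x, net_cvg (N x) x) : linfty_c R `<=` smooth R N.
Proof.
move=> _ [k [c [p [proj_p ->]]]]; apply: (big_ind (smooth R N)) => [|phi psi|i _].
- exact: smooth0.
- exact: smoothD.
- exact/smoothZ/smooth_projection.
Qed.

(** * Density of the combinations of projections *)

(** Each value of psi is weighted by the indicator of its fibre; duplicates are
    removed from s so that each integer lies in the fibre of just one index. *)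
Lemma linfty_c_finite_range {R : realType} (psi : int -> Cplx R)
    (s : seq (Cplx R)) : (forall n, psi n \in s) -> linfty_c R psi.
Proof.
move=> psis; pose t := in_tuple (undup s).
exists (size (undup s)), (tnth t), (fun i n => (psi n == tnth t i)%:R).
split=> [i n|]; first by case: (_ == _); [right|left].
apply/funext => n; rewrite fct_sumE.
rewrite -(big_tnth _ _ _ xpredT (fun z => z * (psi n == z)%:R)).
rewrite (bigD1_seq (psi n)) ?undup_uniq ?mem_undup ?psis //= eqxx mulr1.
by rewrite big1 ?addr0 // => z; rewrite eq_sym => /negPf ->; rewrite mulr0.
Qed.

(** The compactness of beta T in terms of subsets of T: if no finite subfamily
    covered T, the complements would have the finite intersection property, and
    an ultrafilter x containing all of them would contain A x and its
    complement. *)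
Lemma ultrafilter_cover {T : Type} (A : beta T -> set T) :
  (forall x, beta_filter x (A x)) ->
  exists D : seq (beta T), forall t, exists2 x, x \in D & A x t.
Proof.
move=> xA; apply: contrapT => ncover.
have fI : finI setT (fun x => ~` A x).
  move=> D _; apply: contrapT => /nonemptyPn capE.
  apply: ncover; exists (enum_fset D) => t; apply: contrapT => nt.
  have : (\bigcap_(x in [set` D]) ~` A x) t.
    by move=> x xD Axt; apply: nt; exists x.
  by rewrite capE.
have [G [UG fG]] := ultraFilterLemma (finI_filter fI).
pose x := Beta UG.
have GC : G (~` A x).
  apply: fG; exists (~` A x) => //; exists [fset x]%fset.
    by move=> y _; exact: in_setT.
  apply/seteqP; split=> [t|t nAt y]; first by apply; rewrite /= inE.
  by rewrite /= inE => /eqP ->.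
by have /filter_ex[t []] : G (A x `&` ~` A x) by apply: filterI => //; exact: (xA x).
Qed.

Lemma linfty_c_dense {R : realType} : sup_norm_dense (linfty R) (linfty_c R).
Proof.
move=> phi bphi e e0.
have e20 : 0 < (e / 2)%:C%C :> Cplx R by rewrite ltcR divr_gt0.
have [x|D coverD] := @ultrafilter_cover int
    (fun x => [set n | `|beta_ext phi x - phi n| < (e / 2)%:C%C]).
  by have /cvgrPdist_lt := cvg_beta_ext x bphi; exact.
have /choice[c cP] : forall n, exists x, x \in D /\
    `|beta_ext phi x - phi n| < (e / 2)%:C%C.
  by move=> n; have [x] := coverD n; exists x.
exists (fun n => beta_ext phi (c n)).
  apply: (@linfty_c_finite_range _ _ [seq beta_ext phi x | x <- D]) => n.
  by apply: map_f; have [] := cP n.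
(* The approximation uses e / 2 because a supremum of values below e may be e. *)
apply: (@le_lt_trans _ _ (e / 2)); last by rewrite ltr_pdivrMr // ltr_pMr // ltr1n.
by apply: sup_norm_le => n; rewrite distrC; apply: ltW; have [] := cP n.
Qed.

Theorem mainTheorem1 (R : realType) (N : beta int -> net int)
    (hN : forall x : beta int, net_cvg (N x) x) :
  [/\ star_subalgebra (linfty R) (smooth R N),
      sup_norm_dense (linfty R) (smooth R N)
    & linfty_c R `<=` smooth R N].
Proof.
split; last exact: linfty_c_smooth.
- split.
  + by move=> phi [].
  + by split; [exact: smooth0 | exact: smoothD].
  + exact: smoothZ.
  + exact: smoothM.
  + exact: smooth_conj.
- move=> phi bphi e e0; have [psi psi_c psie] := linfty_c_dense phi bphi e e0.
  by exists psi => //; exact: (linfty_c_smooth N hN).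
Qed.
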